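(* Let $E,J,R\in\mathbb{C}^{n,n}$ and $B\in\mathbb{C}^{n,m}$ with $E=E^H\ge 0$, $R=R^H\ge 0$, $J=-J^H$ and $B$ of full column rank (the coefficients of a port-Hamiltonian descriptor system $E\dot x=(J-R)x+Bu$, $y=B^Hx$). Then there exist matrices $F_S=-F_S^H\in\mathbb{C}^{m,m}$ and $F_H=F_H^H\in\mathbb{C}^{m,m}$ such that the pair $(E,\;J+BF_SB^H-(R+BF_HB^H))$ is regular, of index at most one, has all its finite eigenvalues in the open left complex half plane, and $R+BF_HB^H\ge 0$, if and only if $$\operatorname{rank}\begin{bmatrix}E & (J-R)\,\mathcal{S}_\infty(E) & B\end{bmatrix}=n$$ and, for all purely imaginary $s\in\mathbb{C}$, $$\operatorname{rank}\begin{bmatrix}J-R-sE & B\end{bmatrix}=n.$$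
   Context: $\mathbb{C}^{p,q}$ denotes the complex $p\times q$ matrices. For a Hermitian matrix $M$, $M\ge 0$ ($M>0$) means positive semidefinite (positive definite). A pair $(E,A)$ of square matrices (identified with the pencil $\lambda E-A$) is regular if $\det(\lambda_0E-A)\ne 0$ for some $\lambda_0\in\mathbb{C}$. The finite eigenvalues of a regular pair are the $\lambda_0\in\mathbb{C}$ with $\det(\lambda_0E-A)=0$. The index of a regular pair is the size of the largest Jordan block associated with the eigenvalue $\infty$ in its Kronecker (Weierstrass) canonical form, and is $0$ if $E$ is invertible. $\mathcal{S}_\infty(M)$ denotes a full column rank matrix whose columns span the right nullspace of $M$ (a matrix with no columns if the nullspace is trivial). Purely imaginary $s$ means $\Re(s)=0$, including $s=0$. *)

(* Defs.v *)
From HB Require Import structures.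
From mathcomp Require Import all_boot all_order all_algebra.
From mathcomp Require Import reals complex.

Set Implicit Arguments.
Unset Strict Implicit.
Unset Printing Implicit Defensive.

Import Order.TTheory GRing.Theory Num.Theory.

Local Open Scope ring_scope.
Local Open Scope sesquilinear_scope.

Section Pencils.
Variable C : numClosedFieldType.

(* In a numClosedFieldType, [0 <= z] says that z is real and nonnegative. *)
Definition psd n (M : 'M[C]_n) : Prop :=
  M ^t* = M /\ forall x : 'cV[C]_n, 0 <= (x ^t* *m M *m x) 0 0.

Definition right_null_basis n k (M : 'M[C]_n) (S : 'M[C]_(n, k)) : Prop :=
  \rank S = k /\
  forall v : 'cV[C]_n, M *m v = 0 <-> exists w : 'cV[C]_k, v = S *m w.

Definition regular_pair n (E A : 'M[C]_n) : Prop :=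
  exists l : C, \det (l *: E - A) != 0.

Definition finite_eigenvalue n (E A : 'M[C]_n) (l : C) : Prop :=
  \det (l *: E - A) = 0.

Definition jordan_block (a : C) k : 'M[C]_k :=
  \matrix_(i, j) (if i == j then a else if i.+1 == j :> nat then 1 else 0).

(* Weierstrass canonical form of (E, A): kf Jordan blocks of sizes p j with
   finite eigenvalues a j, and ki Jordan blocks of sizes q j for the
   eigenvalue infinity. The equality e only adjusts matrix dimensions. *)
Definition weierstrass_form n (E A : 'M[C]_n)
    kf (p : 'I_kf -> nat) (a : 'I_kf -> C) ki (q : 'I_ki -> nat) : Prop :=
  (forall j, (0 < p j)%N) /\ (forall j, (0 < q j)%N) /\
  exists (e : (\sum_j p j + \sum_j q j)%N = n) (P Q : 'M[C]_n),
    [/\ P \in unitmx, Q \in unitmx,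
        P *m E *m Q = castmx (e, e)
          (block_mx 1%:M 0 0 (\mxdiag_(j < ki) jordan_block 0 (q j))) &
        P *m A *m Q = castmx (e, e)
          (block_mx (\mxdiag_(j < kf) jordan_block (a j) (p j)) 0 0 1%:M)].

(* The index as a relation: the canonical form is unique up to the order of
   the blocks, so nu is determined by (E, A) when the pair is regular. The
   maximum over an empty family is 0, which is the case of invertible E. *)
Definition has_index n (E A : 'M[C]_n) (nu : nat) : Prop :=
  exists kf (p : 'I_kf -> nat) (a : 'I_kf -> C) ki (q : 'I_ki -> nat),
    weierstrass_form E A p a q /\ nu = (\max_(j < ki) q j)%N.

End Pencils.

(* Main.v *)
Require Import Defs.
From HB Require Import structures.
From mathcomp Require Import all_boot all_order all_algebra.
From mathcomp Require Import reals complex.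
From mathcomp Require Import zify ring.

Set Implicit Arguments.
Unset Strict Implicit.
Unset Printing Implicit Defensive.

Import Order.TTheory GRing.Theory Num.Theory.

Local Open Scope ring_scope.
Local Open Scope sesquilinear_scope.

(* The feedback FS = 0, FH = 1 always works. For A = J - R - B B^H and a row
   vector y, the real part of y A y^H is -(y R y^H + |y B|^2), so whenever it
   vanishes, y R = 0 and y B = 0. If y lies in the left kernel of E and
   y A S = 0, the first rank condition then gives y = 0: S^H A S is invertible,
   which for Hermitian E means regular of index at most one. If y is a left
   eigenvector, y E y^H > 0 and Re l = - (y R y^H + |y B|^2) / (y E y^H) < 0 by
   the second rank condition. Conversely, closed-loop and open-loop pencils
   agree on vectors with y B = 0, so a rank defect would contradict the index
   or the eigenvalue condition. The index is read off a Weierstrass form,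
   whose finite part needs the existence of the Jordan normal form. *)

(* The row-freeness and n = m make P and Q invertible; distinct n and m avoid
   casts between provably equal dimensions. *)
Definition pencil_equiv (F : fieldType) n m (E A : 'M[F]_n) (E' A' : 'M[F]_m) :=
  exists (P : 'M[F]_(m, n)) (Q : 'M[F]_(n, m)),
    [/\ n = m, row_free P, row_free Q, P *m E *m Q = E' & P *m A *m Q = A'].

(** * Equivalence of pencils and separation of their infinite part *)

Section PencilEquiv.
Variable F : fieldType.

Lemma row_free_mul m n p (A : 'M[F]_(m, n)) (B : 'M[F]_(n, p)) :
  row_free A -> row_free B -> row_free (A *m B).
Proof. by move=> fA fB; rewrite /row_free mxrankMfree. Qed.

Lemma row_free_full n m (A : 'M[F]_(n, m)) : n = m -> row_free A -> row_full A.
Proof. by move=> e; case: m / e A => A; rewrite row_free_unit row_full_unit. Qed.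

(** Multiplying a vanishing combination of rows by [X] removes the part from [V], so the
    coefficients of [U] vanish first. *)
Lemma row_free_col_mx m1 m2 n p (U : 'M[F]_(m1, n)) (V : 'M[F]_(m2, n))
    (X : 'M[F]_(n, p)) :
  V *m X = 0 -> row_free (U *m X) -> row_free V -> row_free (col_mx U V).
Proof.
move=> VX0 fUX fV; apply: inj_row_free => v.
rewrite -[v]hsubmxK mul_row_col => v0; move: (congr1 (mulmx^~ X) v0).
rewrite mulmxDl -!mulmxA VX0 mulmx0 addr0 mul0mx => /eqP.
rewrite mulmx_free_eq0 // => /eqP l0; move: v0; rewrite l0 mul0mx add0r => /eqP.
by rewrite mulmx_free_eq0 // => /eqP->; rewrite row_mx0.
Qed.

Lemma row_free_col_mxC m1 m2 n (U : 'M[F]_(m1, n)) (V : 'M[F]_(m2, n)) :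
  row_free (col_mx U V) = row_free (col_mx V U).
Proof. by rewrite /row_free -!addsmxE addsmxC addnC. Qed.

Lemma row_free_diag_block m1 m2 n1 n2 (A : 'M[F]_(m1, n1)) (B : 'M[F]_(m2, n2)) :
  row_free A -> row_free B -> row_free (block_mx A 0 0 B).
Proof. by rewrite /row_free rank_diag_block_mx => /eqP-> /eqP->. Qed.

Lemma pencil_equiv_refl n (E A : 'M[F]_n) : pencil_equiv E A E A.
Proof.
exists 1%:M, 1%:M; have f1 : row_free (1%:M : 'M[F]_n).
  by rewrite row_free_unit unitmx1.
by rewrite !mul1mx !mulmx1; split.
Qed.

Lemma pencil_equiv_trans n m p (E A : 'M[F]_n) (E' A' : 'M[F]_m)
    (E'' A'' : 'M[F]_p) :
  pencil_equiv E A E' A' -> pencil_equiv E' A' E'' A'' ->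
  pencil_equiv E A E'' A''.
Proof.
case=> P [Q [e fP fQ <- <-]] [P' [Q' [e' fP' fQ' <- <-]]].
exists (P' *m P), (Q *m Q'); split; rewrite ?row_free_mul ?mulmxA //.
by rewrite e.
Qed.

Lemma pencil_equiv_cast n m (e : n = m) (E A : 'M[F]_n) :
  pencil_equiv E A (castmx (e, e) E) (castmx (e, e) A).
Proof. by case: m / e; rewrite !castmx_id; apply: pencil_equiv_refl. Qed.

Lemma pencil_equiv_castE n m (E A : 'M[F]_n) (E' A' : 'M[F]_m) :
  pencil_equiv E A E' A' -> exists (e : m = n) (P Q : 'M[F]_n),
    [/\ P \in unitmx, Q \in unitmx, P *m E *m Q = castmx (e, e) E' &
        P *m A *m Q = castmx (e, e) A'].
Proof.
case=> P [Q [e]]; case: m / e P Q E' A' => P Q E' A' fP fQ <- <-.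
by exists erefl, P, Q; rewrite -!row_free_unit !castmx_id.
Qed.

Lemma pencil_equiv_block n1 n2 m1 m2 (E1 A1 : 'M[F]_n1) (E2 A2 : 'M[F]_n2)
    (E1' A1' : 'M[F]_m1) (E2' A2' : 'M[F]_m2) :
  pencil_equiv E1 A1 E1' A1' -> pencil_equiv E2 A2 E2' A2' ->
  pencil_equiv (block_mx E1 0 0 E2) (block_mx A1 0 0 A2)
    (block_mx E1' 0 0 E2') (block_mx A1' 0 0 A2').
Proof.
case=> P [Q [e fP fQ <- <-]] [P' [Q' [e' fP' fQ' <- <-]]].
exists (block_mx P 0 0 P'), (block_mx Q 0 0 Q').
split; first by rewrite e e'.
1,2: exact: row_free_diag_block.
all: by rewrite !mulmx_block !(mul0mx, mulmx0, addr0, add0r).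
Qed.

Lemma pencil_equiv_conj n m (A : 'M[F]_n) (A' : 'M[F]_m) (P : 'M[F]_(m, n)) :
  n = m -> row_free P -> P *m A = A' *m P -> pencil_equiv 1%:M A 1%:M A'.
Proof.
move=> e fP PA; exists P, (pinvmx P); split=> //.
- by apply/pinvmx_free/row_free_full.
- by rewrite mulmx1 mulmxVp.
- by rewrite PA -mulmxA mulmxVp // mulmx1.
Qed.

Lemma left_complement n k r (X : 'M[F]_(n, k)) :
  (r + k)%N = n -> \rank X = k -> exists2 L : 'M[F]_(r, n), row_free L & (L :=: kermx X)%MS.
Proof.
move=> e rX; have er : r = \rank (kermx X) by rewrite mxrank_ker rX -e addnK.
rewrite er; exists (row_base (kermx X)); first exact: row_base_free.
exact: eq_row_base.
Qed.

(* For Hermitian E, D is the conjugate transpose of the kernel basis S. *)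
Lemma pencil_split n k r (E A : 'M[F]_n) (S : 'M[F]_(n, k)) (D : 'M[F]_(k, n)) :
  (r + k)%N = n -> \rank E = r -> E *m S = 0 -> D *m E = 0 ->
  D *m A *m S \in unitmx ->
  exists A1 : 'M[F]_r,
    pencil_equiv E A (block_mx 1%:M 0 0 (0 : 'M_k)) (block_mx A1 0 0 1%:M).
Proof.
move=> e rE ES DE uDAS; set G := D *m A *m S in uDAS.
have fG : row_free G by rewrite row_free_unit.
have rG : \rank G = k by apply/eqP.
have rAS : \rank (A *m S) = k.
  apply/eqP; rewrite eqn_leq rank_leq_col -{1}rG /G -mulmxA.
  exact: mxrankM_maxr.
have rDA : \rank (D *m A)^T = k.
  rewrite mxrank_tr; apply/eqP; rewrite eqn_leq rank_leq_row -{1}rG.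
  exact: mxrankM_maxl.
(* [L] annihilates [A *m S] from the left and [D *m A] annihilates [M := N^T], so both off-diagonal
   blocks of [A] will vanish. *)
have [L fL kL] := left_complement e rAS.
have LAS : L *m (A *m S) = 0 by apply/sub_kermxP; rewrite kL.
have [N fN kN] := left_complement e rDA.
have NDA : N *m (D *m A)^T = 0 by apply/sub_kermxP; rewrite kN.
pose M := N^T; have DAM : D *m A *m M = 0.
  by apply: trmx_inj; rewrite trmx_mul trmxK NDA trmx0.
pose D' := invmx G *m D.
have D'AS : D' *m A *m S = 1%:M by rewrite /D' -2!mulmxA (mulmxA D) mulVmx.
have D'AM : D' *m A *m M = 0 by rewrite /D' -2!mulmxA (mulmxA D) DAM mulmx0.
have D'E : D' *m E = 0 by rewrite /D' -mulmxA DE mulmx0.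
have LASz : L *m A *m S = 0 by rewrite -mulmxA LAS.
(* [W] is kept free: [W = 1] shows that [X] is invertible, and [W = invmx X] then normalizes the
   block of [E] to the identity. *)
have fPW (W : 'M[F]_r) : row_free W -> row_free (col_mx (W *m L) D').
  move=> fW; rewrite row_free_col_mxC; apply: (@row_free_col_mx _ _ _ _ _ _ (A *m S)).
  - by rewrite -mulmxA LAS mulmx0.
  - by rewrite mulmxA D'AS row_free_unit unitmx1.
  - exact: row_free_mul.
have fQ : row_free (row_mx M S).
  have: row_free (row_mx M S)^T.
    rewrite tr_row_mx row_free_col_mxC.
    apply: (@row_free_col_mx _ _ _ _ _ _ (D *m A)^T).
    - by rewrite trmxK.
    - by rewrite -trmx_mul row_free_unit unitmx_tr.
    - by rewrite trmxK.
  by rewrite /row_free mxrank_tr => /eqP->; apply/eqP.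
pose X := L *m E *m M.
have PEQ (W : 'M[F]_r) :
    col_mx (W *m L) D' *m E *m row_mx M S = block_mx (W *m X) 0 0 0.
  rewrite mul_col_mx mul_col_row D'E !mul0mx /X !mulmxA.
  by rewrite -(mulmxA _ E S) ES mulmx0.
have fX : row_free X.
  have f1 : row_free (1%:M : 'M[F]_r) by rewrite row_free_unit unitmx1.
  have := congr1 mxrank (PEQ 1%:M).
  rewrite mxrankMfree // eqmxMfull; last exact: row_free_full (fPW _ f1).
  by rewrite rE rank_diag_block_mx mxrank0 addn0 mul1mx => /esym /eqP.
have uX : X \in unitmx by rewrite -row_free_unit.
exists (invmx X *m L *m A *m M), (col_mx (invmx X *m L) D'), (row_mx M S).
split=> //.
- by apply: fPW; rewrite row_free_unit unitmx_inv.
- by rewrite PEQ mulVmx.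
- rewrite mul_col_mx mul_col_row D'AM D'AS; congr block_mx.
  by rewrite -2!mulmxA (mulmxA L) LASz mulmx0.
Qed.

End PencilEquiv.

(** * Existence of the Jordan normal form *)

Section Jordan.
Variable C : numClosedFieldType.

Lemma jordan_blockD (a : C) d : jordan_block a d = jordan_block 0 d + a%:M.
Proof.
apply/matrixP=> i j; rewrite !mxE; case: eqVneq => _.
  by rewrite add0r mulr1n.
by rewrite mulr0n addr0.
Qed.

Lemma jordan_block0_mul d p (X : 'M[C]_(d, p)) i l :
  (jordan_block 0 d *m X) i l =
  if insub i.+1 is Some i' then X i' l else 0.
Proof.
rewrite mxE; case: insubP => [i' _ /= i'E|gd].
  rewrite (bigD1 i') //= big1 ?addr0 => [|j ji']; rewrite !mxE -!val_eqE /= ?i'E.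
    by rewrite eqxx eqn_leq ltnn andbF mul1r.
  case: eqP => _; first by rewrite mul0r.
  by case: eqP => [ij|_]; rewrite ?mul0r //; case/eqP: ji'; apply: val_inj; rewrite /= i'E.
rewrite big1 // => j _; rewrite !mxE; case: eqP => _; first by rewrite mul0r.
by case: eqP => [ij|_]; rewrite ?mul0r //; move: gd; rewrite /= ij ltn_ord.
Qed.

(** The matrix vanishes below its antidiagonal. Column [d.-1 - i] of [v *m G = 0] gives
    [v 0 i * g d.-1 = 0] once the earlier entries of [v] are zero. *)
Lemma hankel_row_free d (g : nat -> C) :
  (forall i, (d <= i)%N -> g i = 0) -> g d.-1 != 0 ->
  row_free (\matrix_(i < d, j < d) g (i + j)%N).
Proof.
move=> g0 gd; apply: inj_row_free => v vG.
suff v0 i : forall j : 'I_d, j = i :> nat -> v 0 j = 0.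
  by apply/rowP=> j; rewrite mxE (v0 j).
elim/ltn_ind: i => i IHi j ji; apply/eqP; rewrite -(mulIr_eq0 _ (mulIf gd)).
have lt_d : (d.-1 - i < d)%N by have := ltn_ord j; lia.
have := congr1 (fun w : 'rV_d => w 0 (Ordinal lt_d)) vG.
rewrite !mxE (bigD1 j) //= big1 ?addr0 => [|l lj]; rewrite !mxE /= ?ji.
  have -> : (i + (d.-1 - i) = d.-1)%N by have := ltn_ord j; lia.
  by move=> ->.
case: (ltngtP l i) => [li|il|/eqP]; first by rewrite (IHi _ li) // mul0r.
  by rewrite g0 ?mulr0 //; have := ltn_ord j; lia.
by rewrite -ji => /eqP/val_inj /eqP; rewrite (negbTE lj).
Qed.

(* With p = q (X - a)^d the minimal polynomial of A and q(a) != 0, the matrix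
   q(A)^2 (A - a)^(d-1) has a nonzero entry (i0, j0). The vectors
   U_i = row i0 of q(A) (A - a)^i span a Jordan chain, and the annihilator of
   the columns j0 of (A - a)^i q(A), i < d, is an invariant complement because
   their Gram matrix is an invertible triangular Hankel matrix. *)
Lemma jordan_split n (A : 'M[C]_n.+1) :
  exists a d r (A' : 'M[C]_r), [/\ (0 < d)%N, (r < n.+1)%N &
    pencil_equiv 1%:M A 1%:M (block_mx (jordan_block a d) 0 0 A')].
Proof.
have [a ra] : exists a, root (mxminpoly A) a.
  apply/closed_rootP; rewrite size_mxminpoly eqSS -lt0n.
  exact: mxminpoly_nonconstant.
have [d [q]] := multiplicity_XsubC (mxminpoly A) a.
rewrite monic_neq0 ?mxminpoly_monic //= => qa mE.
have d0 : (0 < d)%N.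
  by case: d mE => // mE; move: ra; rewrite mE mulr1 (negbTE qa).
pose h i := horner_mx A (q * q * ('X - a%:P) ^+ i).
have h0 i : (d <= i)%N -> h i = 0.
  move=> di; apply/eqP; rewrite -dvd_mxminpoly mE -(subnKC di) exprD.
  by rewrite -!mulrA dvdp_mul ?dvdpp // dvdp_mull // dvdp_mulr.
(* If the minimal polynomial divided this one, cancelling [q * ('X - a%:P) ^+ d.-1] would make [a] a
   root of [q]. *)
have hd : h d.-1 != 0.
  rewrite /h -dvd_mxminpoly mE -(prednK d0) exprSr /= mulrA [X in _ %| X]mulrAC.
  rewrite dvdp_mul2l ?dvdp_XsubCl //.
  rewrite mulf_neq0 ?expf_neq0 ?polyXsubC_eq0 //.
  by apply: contraNneq qa => ->; rewrite root0.
have [i0 [j0 hij]] : exists i0 j0, h d.-1 i0 j0 != 0.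
  case: (pickP (fun ij => h d.-1 ij.1 ij.2 != 0)) => [[i j] /= hij|hz].
    by exists i, j.
  case/eqP: hd; apply/matrixP=> i j; rewrite mxE.
  by apply/eqP; move: (hz (i, j)) => /= /negbFE.
pose N := A - a%:M; have NE : N = horner_mx A ('X - a%:P).
  by rewrite rmorphB /= horner_mx_X horner_mx_C.
pose f i := horner_mx A (q * ('X - a%:P) ^+ i).
have fd : f d = 0 by rewrite /f -mE mx_root_minpoly.
have fN i : f i *m N = f i.+1.
  by rewrite NE /f exprSr mulrA [RHS]rmorphM mulmxE.
have Nf i : N *m f i = f i.+1.
  by rewrite NE /f exprS mulrCA [RHS]rmorphM mulmxE.
have ff i j : f i *m f j = h (i + j)%N.
  by rewrite mulmxE /f -rmorphM /h exprD mulrACA.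
pose U : 'M[C]_(d, n.+1) := \matrix_(i, l) f i i0 l.
pose V : 'M[C]_(d, n.+1) := \matrix_(i, l) f i l j0.
have UN : U *m N = jordan_block 0 d *m U.
  apply/matrixP=> i l; rewrite jordan_block0_mul.
  have -> : (U *m N) i l = f i.+1 i0 l.
    by rewrite -fN !mxE; apply: eq_bigr => s _; rewrite mxE.
  case: insubP => [i' _ <-|]; first by rewrite mxE.
  rewrite -leqNgt => di; have -> : i.+1 = d by apply/eqP; rewrite eqn_leq di ltn_ord.
  by rewrite fd mxE.
have NV : N *m V^T = V^T *m (jordan_block 0 d)^T.
  rewrite -trmx_mul; apply/matrixP=> l i; rewrite [RHS]mxE jordan_block0_mul.
  have -> : (N *m V^T) l i = f i.+1 l j0.
    by rewrite -Nf !mxE; apply: eq_bigr => s _; rewrite !mxE.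
  case: insubP => [i' _ <-|]; first by rewrite mxE.
  rewrite -leqNgt => di; have -> : i.+1 = d by apply/eqP; rewrite eqn_leq di ltn_ord.
  by rewrite fd mxE.
have fUV : row_free (U *m V^T).
  have -> : U *m V^T = \matrix_(i, j) h (i + j)%N i0 j0.
    apply/matrixP=> i j; rewrite [RHS]mxE -ff !mxE.
    by apply: eq_bigr => s _; rewrite !mxE.
  by apply: (@hankel_row_free d (fun i => h i i0 j0)) => // i /h0->; rewrite mxE.
have rV : \rank V^T = d.
  apply/eqP; rewrite eqn_leq rank_leq_col -{1}(eqP fUV).
  exact: mxrankM_maxr.
have dn : (d <= n.+1)%N by rewrite -rV rank_leq_row.
have [W fW kW] := left_complement (subnK dn) rV.
have WV : W *m V^T = 0 by apply/sub_kermxP; rewrite kW.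
(* [N *m V^T] factors through [V^T], so the left kernel of [V^T] is stable under [N], which acts on
   it as [M]. *)
have /submxP[M WN] : (W *m N <= W)%MS.
  by rewrite kW; apply/sub_kermxP; rewrite -mulmxA NV mulmxA WV mul0mx.
exists a, d, (n.+1 - d)%N, (M + a%:M); split; first by [].
  by rewrite ltn_subrL d0.
apply: (@pencil_equiv_conj _ _ _ _ _ (col_mx U W)).
- by rewrite subnKC.
- exact: (row_free_col_mx WV).
rewrite mul_block_col mul_col_mx !mul0mx addr0 add0r jordan_blockD !mulmxDl.
by rewrite -UN -WN -!scalar_mxC -!mulmxDr subrK.
Qed.

Lemma castmx1 r p (e : r = p) : castmx (e, e) 1%:M = 1%:M :> 'M[C]_p.
Proof. by case: p / e; rewrite castmx_id. Qed.

(** [jordan_split] leaves a strictly smaller matrix, so strong induction on [n] applies. The list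
    holds pairs of eigenvalue and size; the default of [nth] is never reached. *)
Lemma jordan_form n (A : 'M[C]_n) : exists2 s : seq (C * nat),
  all (fun ap => 0 < ap.2)%N s &
  pencil_equiv 1%:M A 1%:M
    (\mxdiag_(j < size s) jordan_block (nth (0, 0%N) s j).1 (nth (0, 0%N) s j).2).
Proof.
elim/ltn_ind: n A => -[|n] IHn A.
  exists [::] => //; exists 0, 0; split.
  - by rewrite big_ord0.
  - by apply/eqP; rewrite mxrank0 big_ord0.
  - by rewrite /row_free mxrank0.
  - by apply/matrixP=> i; have := ltn_ord i; rewrite {2}big_ord0.
  - by apply/matrixP=> i; have := ltn_ord i; rewrite {2}big_ord0.
have [a [d [r [A' [d0 rn AA']]]]] := jordan_split A.
have [s sp A's] := IHn _ rn A'.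
exists ((a, d) :: s) => /=; first by rewrite d0.
apply: (pencil_equiv_trans AA').
rewrite mxdiag_recl.
set D := mxdiag _ in A's *; move: D A's.
(* This generalizes the dimension equation hidden in the cast, which [pencil_equiv_cast] then
   absorbs. *)
match goal with |- context [castmx (?e, ?e) _] => move: e end.
move=> /= e D A's.
rewrite -(castmx1 e).
apply: pencil_equiv_trans (pencil_equiv_cast e _ _).
rewrite !scalar_mx_block.
apply: pencil_equiv_block A's; exact: pencil_equiv_refl.
Qed.

End Jordan.

(** * Index at most one and the kernel of [E] *)

Section Index.
Variable C : numClosedFieldType.

Lemma jordan_block_nilp1 ki (q : 'I_ki -> nat) :
  (forall j, q j <= 1)%N -> \mxdiag_(j < ki) jordan_block (0 : C) (q j) = 0.
Proof.
move=> q1; rewrite -[RHS]mxdiag0; apply: eq_mxdiag => j; apply/matrixP=> i i'.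
rewrite !mxE; case: eqP => // _; case: eqP => // ii'.
by have := ltn_ord i'; rewrite -ii' ltnNge (leq_trans (q1 j)).
Qed.

Lemma index_le1 n k r (E A : 'M[C]_n) (A1 : 'M_r) :
  pencil_equiv E A (block_mx 1%:M 0 0 (0 : 'M_k)) (block_mx A1 0 0 1%:M) ->
  exists2 nu, has_index E A nu & (nu <= 1)%N.
Proof.
move=> EA; have [s /allP sp A1s] := jordan_form A1.
(* All [k] infinite blocks have size 1, so this is 1, or 0 when [k = 0]. *)
exists (\max_(j < k) 1)%N; last exact/bigmax_leqP.
exists (size s), (fun j => (nth (0, 0%N) s j).2), (fun j => (nth (0, 0%N) s j).1).
exists k, (fun=> 1%N); split=> //; split; last split=> //.
  by move=> j; apply/sp/mem_nth.
apply/pencil_equiv_castE/(pencil_equiv_trans EA)/(pencil_equiv_block A1s).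
rewrite jordan_block_nilp1 //.
have e : k = (\sum_(j < k) 1)%N by rewrite sum1_card card_ord.
have /= := pencil_equiv_cast e (0 : 'M[C]_k) 1%:M.
by rewrite castmx1 castmx_const.
Qed.

(** In Weierstrass coordinates [E] is the identity on the finite part and zero on the infinite part.
    Hence [y *m E = 0] kills the finite part of [y]. The infinite part of the right coordinates maps
    into the span of [S], and [A] is the identity there, so the rest of [y] vanishes too. *)
Lemma index_le1_null n k (E A : 'M[C]_n) (S : 'M[C]_(n, k)) nu (y : 'rV_n) :
  has_index E A nu -> (nu <= 1)%N -> right_null_basis E S ->
  y *m E = 0 -> y *m A *m S = 0 -> y = 0.
Proof.
case=> kf [p [a [ki [q [[_ [_ [e [P [Q [uP uQ PEQ PAQ]]]]]] ->]]]]] /bigmax_leqP q1.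
case=> _ ES yE yAS; rewrite jordan_block_nilp1 in PEQ; last by move=> j; apply: q1.
move: PEQ PAQ; set Jf := mxdiag _; move: Jf.
move: (\sum_j p j)%N (\sum_j q j)%N e => r l e; move: E A S P Q y uP uQ ES yE yAS.
case: n / e => E A S P Q y uP uQ ES yE yAS Jf; rewrite !castmx_id => PEQ PAQ.
pose z := y *m invmx P.
have yz : y = z *m P by rewrite /z mulmxKV.
have zE : z *m (P *m E *m Q) = 0 by rewrite !mulmxA -yz yE mul0mx.
have zl : lsubmx z = 0.
  move: zE; rewrite PEQ -[z]hsubmxK mul_row_block !mulmx0 mulmx1 !addr0.
  by rewrite -row_mx0 row_mxKl => /eq_row_mx[].
have zr : rsubmx z = 0.
  apply/rowP=> j; rewrite [RHS]mxE.
  pose w : 'cV[C]_(r + l) := col_mx 0 (delta_mx j 0).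
  have Ew : E *m (Q *m w) = 0.
    apply: (can_inj (mulKmx uP)); rewrite mulmx0 !mulmxA PEQ /w.
    by rewrite mul_block_col !(mulmx0, mul0mx) !addr0 col_mx0.
  have [u Su] := (ES _).1 Ew.
  have : z *m (P *m A *m Q) *m w = 0.
    by rewrite !mulmxA -yz -mulmxA Su mulmxA yAS mul0mx.
  rewrite PAQ -[z]hsubmxK mul_row_block !mulmx0 zl mul0mx !add0r mulmx1 /w.
  by rewrite mul_row_col mulmx0 add0r -colE => /colP/(_ 0); rewrite row_mxKr !mxE.
by rewrite yz -[z]hsubmxK zl zr row_mx0 mul0mx.
Qed.

Lemma right_null_basis_mul n k (E : 'M[C]_n) (S : 'M[C]_(n, k)) :
  right_null_basis E S -> E *m S = 0.
Proof.
case=> _ ES; apply/matrixP=> i j.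
have : E *m (S *m (delta_mx j 0 : 'cV_k)) = 0 by apply/ES; exists (delta_mx j 0 : 'cV_k).
by rewrite mulmxA -colE => /colP/(_ i); rewrite !mxE.
Qed.

Lemma rank_right_null_basis n k (E : 'M[C]_n) (S : 'M[C]_(n, k)) :
  right_null_basis E S -> (\rank E + k)%N = n.
Proof.
move=> nS; have [rS ES] := nS.
have eSE : (S^T :=: kermx E^T)%MS.
  apply/eqmxP/andP; split.
    apply/sub_kermxP; by rewrite -trmx_mul right_null_basis_mul // trmx0.
  apply/row_subP=> i; have : E *m (row i (kermx E^T))^T = 0.
    by apply: trmx_inj; rewrite trmx_mul trmxK -row_mul mulmx_ker row0 trmx0.
  case/ES => w /(congr1 trmx); rewrite trmxK trmx_mul => ->; exact: submxMl.
rewrite -{1}rS -[\rank S]mxrank_tr eSE mxrank_ker mxrank_tr subnKC //.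
exact: rank_leq_row.
Qed.

End Index.

(** * Hermitian forms and positive semidefiniteness *)

Section Hermitian.
Variable C : numClosedFieldType.

Lemma trmxC_mul m n p (A : 'M[C]_(m, n)) (B : 'M[C]_(n, p)) :
  (A *m B) ^t* = B ^t* *m A ^t*.
Proof. by rewrite trmx_mul map_mxM. Qed.

Lemma trmxCD m n (A B : 'M[C]_(m, n)) : (A + B) ^t* = A ^t* + B ^t*.
Proof. by rewrite linearD map_mxD. Qed.

Lemma trmxCN m n (A : 'M[C]_(m, n)) : (- A) ^t* = - A ^t*.
Proof. by rewrite linearN map_mxN. Qed.

Lemma trmxCZ m n a (A : 'M[C]_(m, n)) : (a *: A) ^t* = a^* *: A ^t*.
Proof. by rewrite linearZ map_mxZ. Qed.

Lemma gram_ge0 n (y : 'rV[C]_n) : 0 <= (y *m y ^t*) 0 0.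
Proof. by rewrite mxE sumr_ge0 // => i _; rewrite !mxE mul_conjC_ge0. Qed.

Lemma gram_eq0 n (y : 'rV[C]_n) : (y *m y ^t*) 0 0 = 0 -> y = 0.
Proof.
rewrite mxE => y0; apply/rowP=> i; rewrite mxE; apply/eqP; rewrite -mul_conjC_eq0.
have ge0 j : true -> 0 <= y 0 j * (y ^t*) j 0 by rewrite !mxE mul_conjC_ge0.
by have /= := psumr_eq0P ge0 y0 (i := i) isT; rewrite !mxE => ->.
Qed.

(** Row vectors are used because the rank conditions are tested on left null vectors and the
    eigenvectors are left ones. *)
Definition hform n (M : 'M[C]_n) (y : 'rV[C]_n) : C := (y *m M *m y ^t*) 0 0.

Lemma psd_hform_ge0 n (M : 'M[C]_n) y : psd M -> 0 <= hform M y.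
Proof. by case=> _ /(_ (y ^t*)); rewrite trmxCK. Qed.

Lemma hformD n (M N : 'M[C]_n) y : hform (M + N) y = hform M y + hform N y.
Proof. by rewrite /hform mulmxDr mulmxDl mxE. Qed.

Lemma hformN n (M : 'M[C]_n) y : hform (- M) y = - hform M y.
Proof. by rewrite /hform mulmxN mulNmx mxE. Qed.

Lemma hformZ n a (M : 'M[C]_n) y : hform (a *: M) y = a * hform M y.
Proof. by rewrite /hform -scalemxAr -scalemxAl mxE. Qed.

Lemma hform_conj n (M : 'M[C]_n) y : (hform M y)^* = hform (M ^t*) y.
Proof.
have -> : (hform M y)^* = ((y *m M *m y ^t*) ^t*) 0 0.
  by rewrite [RHS]mxE [in RHS]mxE.
by rewrite !trmxC_mul trmxCK mulmxA.
Qed.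

(** For [z = y *m M] and real [t], the form at [y - t *: z] equals [- 2 t c + t ^+ 2 * b], which is
    negative for small positive [t] unless [c = 0]. *)
Lemma psd_hform_eq0 n (M : 'M[C]_n) (y : 'rV[C]_n) :
  psd M -> hform M y = 0 -> y *m M = 0.
Proof.
move=> pM; have [hM _] := pM; move=> My0; apply: gram_eq0.
set z := y *m M; set c := (z *m z ^t*) 0 0.
have c0 : 0 <= c by exact: gram_ge0.
pose b := hform M z; have b0 : 0 <= b by exact: psd_hform_ge0.
have zy : (z *m y ^t*) 0 0 = 0 := My0.
have zMy : (z *m M *m y ^t*) 0 0 = c by rewrite -mulmxA -{1}hM -trmxC_mul.
have subE (A B : 'M[C]_1) : (A - B) 0 0 = A 0 0 - B 0 0 by rewrite !mxE.
have scaleE a (A : 'M[C]_1) : (a *: A) 0 0 = a * A 0 0 by rewrite mxE.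
(* The denominator [b + 1] is positive even if [b = 0], and the form becomes
   [- (t ^+ 2 * (b + 2))]. *)
pose t := c / (b + 1); have b1 : 0 < b + 1 by rewrite ltr_wpDl.
have t0 : 0 <= t by rewrite divr_ge0 // ltW.
have cE : c = t * (b + 1) by rewrite divfK ?gt_eqF.
have := psd_hform_ge0 (y - t *: z) pM.
rewrite /hform trmxCD trmxCN trmxCZ (CrealP (ger0_real t0)).
rewrite mulmxBl -/z mulmxBr !mulmxBl -!scalemxAl -!scalemxAr !(subE, scaleE).
rewrite zy zMy -/c -[(z *m M *m z ^t*) 0 0]/b.
have -> : 0 - t * c - (t * c - t * (t * b)) = - (t ^+ 2 * (b + 2)) by rewrite cE; ring.
rewrite oppr_ge0 => le0; suff: t = 0 by rewrite cE => ->; rewrite mul0r.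
apply/eqP; rewrite -sqrf_eq0 -(mulIr_eq0 _ (mulIf (_ : b + 2 != 0))).
  by rewrite eq_le le0 mulr_ge0 ?exprn_ge0 // addr_ge0.
by rewrite gt_eqF // ltr_wpDl.
Qed.

Lemma skew_hform_Re n (M : 'M[C]_n) (y : 'rV[C]_n) :
  M ^t* = - M -> 'Re (hform M y) = 0.
Proof. by move=> hM; rewrite ReE hform_conj hM hformN subrr mul0r. Qed.

Lemma psd_addBB n m (M : 'M[C]_n) (B : 'M[C]_(n, m)) :
  psd M -> psd (M + B *m B ^t*).
Proof.
move=> pM; split; first by rewrite trmxCD pM.1 trmxC_mul trmxCK.
move=> x; rewrite mulmxDr mulmxDl mxE addr_ge0 //; first exact: pM.2.
by have := gram_ge0 (x ^t* *m B); rewrite trmxC_mul trmxCK !mulmxA.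
Qed.

Lemma psd_addBB_eq0 n m (M : 'M[C]_n) (B : 'M[C]_(n, m)) (y : 'rV_n) :
  psd M -> hform (M + B *m B ^t*) y = 0 -> y *m M = 0 /\ y *m B = 0.
Proof.
move=> pM; have eB : hform (B *m B ^t*) y = (y *m B *m (y *m B) ^t*) 0 0.
  by rewrite /hform trmxC_mul !mulmxA.
rewrite hformD eB => /eqP; rewrite paddr_eq0 ?gram_ge0 ?psd_hform_ge0 //.
by case/andP=> /eqP/(psd_hform_eq0 pM)-> /eqP/gram_eq0->.
Qed.

End Hermitian.

(** * Regularization and stabilization by output feedback *)

Theorem theorem9 (K : realType) (n m k : nat)
    (E J R : 'M[K[i]]_n) (B : 'M[K[i]]_(n, m)) (S : 'M[K[i]]_(n, k))
    (hE : psd E) (hR : psd R) (hJ : J ^t* = - J) (hB : \rank B = m)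
    (hS : right_null_basis E S) :
  (exists FS FH : 'M[K[i]]_m,
     FS ^t* = - FS /\ FH ^t* = FH /\
     let A := J + B *m FS *m B ^t* - (R + B *m FH *m B ^t*) in
     [/\ regular_pair E A,
         exists2 nu, has_index E A nu & (nu <= 1)%N,
         forall l : K[i], finite_eigenvalue E A l -> 'Re l < 0 &
         psd (R + B *m FH *m B ^t*)])
  <->
  (\rank (row_mx (row_mx E ((J - R) *m S)) B) = n /\
   forall s : K[i], 'Re s = 0 -> \rank (row_mx (J - R - s *: E) B) = n).

Proof.
have nE := rank_right_null_basis hS; have ES := right_null_basis_mul hS.
have AE (FS FH : 'M[K[i]]_m) : J + B *m FS *m B ^t* - (R + B *m FH *m B ^t*) =
    J - R + B *m (FS - FH) *m B ^t*.
  by rewrite mulmxBr mulmxBl opprD addrACA.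
split=> [[FS [FH [_ [_]]]] /=|[rk1 rk2]].
  rewrite AE; set A := (X in regular_pair E X) => -[_ [nu iA nu1] stA _].
  have yA (y : 'rV_n) : y *m B = 0 -> y *m A = y *m (J - R).
    by move=> yB; rewrite /A mulmxDr !mulmxA yB !mul0mx addr0.
  split=> [|s s0]; apply/eqP; apply: inj_row_free => y.
    rewrite !mul_mx_row -[0]row_mx0 => /eq_row_mx[].
    rewrite -[0]row_mx0 => /eq_row_mx[yE yJS] yB.
    by apply: (index_le1_null iA nu1 hS); rewrite // yA // -mulmxA.
  rewrite mul_mx_row -[0]row_mx0 => /eq_row_mx[yJ yB].
  apply/eqP/negPn/negP => y0.
  (* A left null vector of the second matrix is a closed-loop left eigenvector for an eigenvalue on
     the imaginary axis. *)
  have /stA : finite_eigenvalue E A s.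
    apply/eqP/det0P; exists y => //.
    by rewrite mulmxBr yA // -mulmxBr -opprB mulmxN yJ oppr0.
  by rewrite s0 ltxx.
exists 0, 1%:M; rewrite trmx0 map_mx0 oppr0 trmx1 map_mx1; do 2!split=> //.
rewrite mulmx0 mul0mx addr0 mulmx1 => A; set R' := R + _ in A *.
have pR' : psd R' by exact: psd_addBB.
have R'0 (y : 'rV_n) : hform R' y = 0 -> [/\ y *m R = 0, y *m B = 0 & y *m A = y *m J].
  case/(psd_addBB_eq0 hR) => yR yB; split=> //.
  by rewrite mulmxBr mulmxDr yR mulmxA yB mul0mx addr0 subr0.
have ReA y : 'Re (hform A y) = - hform R' y.
  rewrite hformD hformN raddfD /= (skew_hform_Re _ hJ) add0r raddfN /=.
  by rewrite (Creal_ReP _ (ger0_real (psd_hform_ge0 y pR'))).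
have yS0 (y : 'rV_n) : y *m E = 0 -> y *m A *m S = 0 -> y = 0.
  (* As [E] is Hermitian, [y ^t*] lies in its right kernel and equals [S *m w]; thus
     [hform A y = 0]. *)
  move=> yE yAS; have [w wS] : exists w : 'cV_k, y ^t* = S *m w.
    by apply/(hS.2 (y ^t*)); rewrite -{1}hE.1 -trmxC_mul yE trmx0 map_mx0.
  have Ay0 : hform A y = 0 by rewrite /hform wS mulmxA yAS mul0mx mxE.
  have [] := R'0 y; first by apply/eqP; rewrite -oppr_eq0 -ReA Ay0 raddf0.
  move=> yR yB yA; have /row_free_inj : row_free (row_mx (row_mx E ((J - R) *m S)) B).
    exact/eqP.
  apply; rewrite mul0mx !mul_mx_row yE yB mulmxA mulmxBr yR subr0 -yA yAS.
  by rewrite !row_mx0.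
have st l : finite_eigenvalue E A l -> 'Re l < 0.
  move/eqP/det0P=> [y y0]; rewrite mulmxBr -scalemxAr => /eqP.
  rewrite subr_eq0 => /eqP lE.
  have hl : l * hform E y = hform A y.
    by rewrite -hformZ /hform -scalemxAr lE.
  (* Otherwise [y *m E = 0], so the eigenvalue equation gives [y *m A = 0], and [yS0] forces
     [y = 0]. *)
  have Ey : 0 < hform E y.
    rewrite lt_def psd_hform_ge0 // andbT; apply: contraNneq y0 => Ey0.
    have yE := psd_hform_eq0 hE Ey0; apply/eqP/yS0 => //.
    by rewrite -lE yE scaler0 mul0mx.
  have Rl : 'Re l * hform E y = - hform R' y.
    by rewrite -ReA -hl ReMr // ger0_real // ltW.
  rewrite -(pmulr_llt0 _ Ey) Rl oppr_lt0 lt_def psd_hform_ge0 // andbT.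
  apply: contraNneq y0 => /[dup] Ry0 /R'0[yR yB yA].
  have l0 : 'Re l = 0.
    by move/eqP: Rl; rewrite Ry0 oppr0 mulf_eq0 (gt_eqF Ey) orbF => /eqP.
  have /row_free_inj fr : row_free (row_mx (J - R - l *: E) B) by apply/eqP/rk2.
  apply/eqP/fr; rewrite mul0mx mul_mx_row yB !mulmxBr yR subr0 -scalemxAr lE yA.
  by rewrite subrr row_mx0.
split=> //.
  (* Every root of the determinant has negative real part, so 1 is not a root. *)
  exists 1; apply/eqP => /st; rewrite (Creal_ReP _ (rpred1 _)).
  by rewrite ltr10.
(* For [w] in the left kernel, [yS0] applies to [w *m S ^t*], and the full column rank of [S] gives
   [w = 0]. *)
have uS : S ^t* *m A *m S \in unitmx.
  rewrite -row_free_unit; apply: inj_row_free => w; rewrite !mulmxA => wS.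
  have /yS0 : w *m S ^t* *m E = 0.
    by rewrite -mulmxA -[E]hE.1 -trmxC_mul ES trmx0 map_mx0 mulmx0.
  move/(_ wS)/eqP; rewrite mulmx_free_eq0 => [/eqP //|].
  by rewrite /row_free mxrank_map mxrank_tr hS.1.
have [|A1 EA] := pencil_split nE erefl ES _ uS.
  by rewrite -[E]hE.1 -trmxC_mul ES trmx0 map_mx0.
exact: index_le1 EA.
Qed.
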